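(* Let $u>0$, $t\ge0$ with $\xi t/u-t+1>0$. If the game $(a(x),F(x))$ is effective, then the iterated limits and the double limit below exist and $$\lim_{N\to+\infty}\left(\lim_{n\to+\infty}E[X_{N,n}]\right)=\lim_{n\to+\infty}\left(\lim_{N\to+\infty}E[X_{N,n}]\right)=\lim_{\substack{n\to+\infty\\N\to+\infty}}E[X_{N,n}]<+\infty .$$ If the game is not effective (ineffective) and $t>0$, then $\lim_{N\to+\infty}E[X_{N,n}]=+\infty$ for each $n\ge1$.
   Context: Setting: $I\subseteq\mathbb R$ is an interval, $F$ is a probability distribution function on $I$, and $\int_I g(x)\,d(F(x))$ is the Lebesgue–Stieltjes integral with respect to the associated probability measure. $a:I\to\mathbb R$ is measurable, $\xi:=\inf_{x\in I}a(x)>-\infty$, and $\xi$ is the essential infimum of $a$: $\int_{a(x)<\xi+\varepsilon}d(F(x))>0$ for all $\varepsilon>0$. $a$ is not a.e. constant. $\int_I a(x)\,d(F(x))\in(0,+\infty]$. The game $(a(x),F(x))$ is called effective if $\int_{a(x)>1}a(x)^\nu d(F(x))<+\infty$ for some $\nu>0$ (in addition to the standing conditions $\int_I a\,dF>0$ and $\xi>-\infty$). $(f_N)_{N\ge1}$ is a sequence of step functions on $I$ with $\xi\le f_N(x)\le f_{N+1}(x)\le a(x)$ and $\lim_{N\to\infty}f_N(x)=a(x)$ for all $x\in I$. Each $f_N$ has finitely many levels $\xi=a_1<a_2<\dots<a_M$ ($M$ and the $a_j$ depending on $N$), with $f_N(x)=a_j$ when $a_j\le a(x)<a_{j+1}$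 ($1\le j\le M-1$) and $f_N(x)=a_M$ when $a(x)\ge a_M$. (Example: $M=2^NN+1$, $a_j=\xi+(j-1)/2^N$.) Put $p_j:=\int_{a_j\le a(x)<a_{j+1}}d(F(x))$ for $j\le M-1$ and $p_M:=\int_{a(x)\ge a_M}d(F(x))$. For $u>0$, $t\ge0$ with $\xi t/u-t+1>0$, $X_{N,n}$ is the growth rate per attempt after $n$ attempts in the game $\{(a_j,p_j)\}$: $X_{N,n}=\left(\prod_{i=1}^n(Y_it/u-t+1)\right)^{1/n}$ with $Y_1,\dots,Y_n$ i.i.d., $P(Y_i=a_j)=p_j$. Thus $E[X_{N,n}]=\left(\sum_{j=1}^M(a_jt/u-t+1)^{1/n}p_j\right)^n$. The double limit means $n$ and $N$ tend to infinity jointly. *)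

(* Defs.v *)
From HB Require Import structures.
From mathcomp Require Import all_boot all_order all_algebra.
From mathcomp Require Import all_classical all_reals all_analysis.

Set Implicit Arguments.
Unset Strict Implicit.
Unset Printing Implicit Defensive.
Import Order.TTheory GRing.Theory Num.Theory.
Import numFieldNormedType.Exports.
Local Open Scope classical_set_scope.
Local Open Scope ring_scope.

(* The probability measure on the Borel sets of the real line associated with
   a distribution function F (nondecreasing, right-continuous, with limits 0
   at -oo and 1 at +oo). *)
Definition dF (R : realType) (F : cumulativeBounded (0 : R) (1 : R)) :
    probability (measurableTypeR R) R :=
  lebesgue_stieltjes_measure F.

(* The standing conditions on a game (\int a > 0 and inf a > -oo) are not
   repeated here. *)
Definition effective (R : realType) (mu : probability (measurableTypeR R) R)
    (I : interval R) (a : R -> R) : Prop :=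
  exists nu : R, 0 < nu /\
    (\int[mu]_(x in [set` I] `&` [set x | (1 < a x)%R]) (a x `^ nu)%R%:E < +oo)%E.

(* Levels are indexed from 0: l 0 < ... < l m are the m + 1 levels, and the
   values l j for j > m are irrelevant.  For j < m this is the set where
   l j <= a < l (j + 1), for j = m the set where l m <= a. *)
Definition level_set (R : realType) (I : interval R) (a : R -> R) (m : nat)
    (l : nat -> R) (j : nat) : set R :=
  [set x | [/\ x \in I, l j <= a x & (j < m)%N -> a x < l j.+1]].

Definition step_approx (R : realType) (I : interval R) (a : R -> R) (xi : R)
    (m : nat) (l : nat -> R) (f : R -> R) : Prop :=
  [/\ l 0%N = xi,
      forall j, (j < m)%N -> l j < l j.+1 &
      forall j x, (j <= m)%N -> level_set I a m l j x -> f x = l j].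

Definition mutually_independent (R : realType) (d : measure_display)
    (T : measurableType d) (P : probability T R) (Y : nat -> {RV P >-> R}) :
    Prop :=
  forall (s : seq nat) (B : nat -> set R), uniq s ->
    (forall i, measurable (B i)) ->
    P (\bigcap_(i in [set` s]) (Y i @^-1` B i)) =
    (\prod_(i <- s) P (Y i @^-1` B i))%E.

(* Y_0, Y_1, ... are i.i.d. with P(Y_i = l j) = p j for 0 <= j <= m; the p j
   will sum to 1, so this determines the common law. *)
Definition iid_draws (R : realType) (d : measure_display)
    (T : measurableType d) (P : probability T R) (Y : nat -> {RV P >-> R})
    (m : nat) (l : nat -> R) (p : nat -> \bar R) : Prop :=
  mutually_independent Y /\
  forall i j, (j <= m)%N -> P (Y i @^-1` [set l j]) = p j.

(* Meaningful for n > 0. *)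
Definition growth_rate (R : realType) (T : Type) (u t : R) (Y : nat -> T -> R)
    (n : nat) (w : T) : R :=
  (\prod_(i < n) (Y i w * t / u - t + 1)) `^ n%:R^-1.

(* Main.v *)
(* Let g = a t / u - t + 1 and let g_N be its step approximation, so that
   E[X_{N,n}] = (\int g_N^(1/n) dF)^n by independence.  Jensen's inequality and
   monotonicity in N give
     exp (\int ln g_N dF) <= E[X_{N,n}] <= (\int g^(1/n) dF)^n.
   If the game is effective, the lower bound tends to L = exp (\int ln g dF) by
   dominated convergence, and so does the upper bound because
   \int g^(1/n) dF <= 1 + (\int ln g dF) / n + K / n^2.  Everything is thus
   squeezed to L.  If it is not effective, \int g^(1/n) dF = +oo for every n,
   and monotone convergence in N applies. *)
Require Import Defs.
From HB Require Import structures.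
From mathcomp Require Import all_boot all_order all_algebra.
From mathcomp Require Import all_classical all_reals all_analysis.
From mathcomp Require Import measurable_realfun ring lra.

Set Implicit Arguments.
Unset Strict Implicit.
Unset Printing Implicit Defensive.
Import Order.TTheory GRing.Theory Num.Theory.
Import numFieldNormedType.Exports.
Local Open Scope classical_set_scope.
Local Open Scope ring_scope.

(** * Elementary bounds for the exponential *)

Lemma expR_le_1DxM (R : realType) (z : R) : expR z <= 1 + z * expR z.
Proof.
have := expR_ge1Dx (- z); rewrite -(ler_pM2r (expR_gt0 z)).
rewrite -expRD addNr expR0 mulrDl mul1r mulNr; lra.
Qed.

(** Two uses of [expR z <= 1 + z * expR z] leave a remainder of order [s ^+ 2] whose coefficient
    must stay integrable: for [y <= 0] the lower bound [b] controls it, and for [y >= 0] the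
    condition [s <= nu / 2] lets [expR (nu * y)] absorb [y ^+ 2 * expR (s * y)]. *)
Lemma expR_quadratic_bound (R : realType) (b nu s y : R) :
  0 < nu -> 0 <= s -> s <= nu / 2 -> b <= y ->
  expR (s * y) <= 1 + s * y + s ^+ 2 * (b ^+ 2 + 16 / nu ^+ 2 * expR (nu * y)).
Proof.
move=> nu0 s0 snu yb; have := expR_le_1DxM (s * y); set z := s * y => ez.
have b2 : 0 <= s ^+ 2 * b ^+ 2 by rewrite mulr_ge0 ?sqr_ge0.
have [y0|/ltW y0] := leP 0 y; last first.
  have z0 : z <= 0 by rewrite /z mulr_ge0_le0.
  have zz : z * expR z <= z * (1 + z) by rewrite ler_wnM2l// expR_ge1Dx.
  have : z ^+ 2 <= s ^+ 2 * b ^+ 2.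
    rewrite /z exprMn; apply: ler_wpM2l; first exact: sqr_ge0.
    by rewrite -[y ^+ 2]sqrrN -[b ^+ 2]sqrrN lerXn2r// ?nnegrE; lra.
  have : 0 <= s ^+ 2 * (16 / nu ^+ 2 * expR (nu * y)).
    by rewrite !mulr_ge0 ?sqr_ge0 ?expR_ge0// invr_ge0 sqr_ge0.
  by rewrite mulrDr; nra.
have z0 : 0 <= z by rewrite /z mulr_ge0.
have zz : z * (expR z - 1) <= z * (z * expR z) by rewrite ler_wpM2l//; lra.
(* Half of the exponent [nu * y] is reserved for [expR z], the other half for [y ^+ 2]; hence [y]
   itself is compared with [expR (nu * y / 4)], and 16 is the square of this 4. *)
have y4 : y <= 4 / nu * expR (nu * y / 4).
  have e4 := expR_ge1Dx (nu * y / 4).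
  have yE : y = 4 / nu * (nu * y / 4) by field; rewrite gt_eqF.
  rewrite [leLHS]yE; apply: ler_wpM2l; first by rewrite divr_ge0// ltW.
  lra.
have y2 : y ^+ 2 <= 16 / nu ^+ 2 * expR (nu * y / 2).
  have -> : 16 / nu ^+ 2 * expR (nu * y / 2) =
      (4 / nu * expR (nu * y / 4)) ^+ 2.
    rewrite exprMn -expRM_natl; congr (_ * expR _); last by field.
    by field; rewrite gt_eqF.
  by rewrite lerXn2r// nnegrE (le_trans y0).
have ze : expR z <= expR (nu * y / 2) by rewrite ler_expR /z; nra.
have zz2 : z ^+ 2 * expR z <= s ^+ 2 * (16 / nu ^+ 2 * expR (nu * y)).
  have -> : z ^+ 2 * expR z = s ^+ 2 * (y ^+ 2 * expR z).
    by rewrite /z exprMn mulrA.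
  apply: ler_wpM2l; first exact: sqr_ge0.
  have -> : expR (nu * y) = expR (nu * y / 2) * expR (nu * y / 2).
    by rewrite -expRD; congr expR; field.
  by rewrite mulrA ler_pM ?sqr_ge0 ?expR_ge0.
by rewrite mulrDr; nra.
Qed.

(** * Integrability from a finite exponential moment *)

Lemma integrable_ge0 d (T : measurableType d) (R : realType)
    (mu : {measure set T -> \bar R}) (h : T -> R) :
  measurable_fun [set: T] h -> (forall x, 0 <= h x) ->
  (\int[mu]_x (h x)%:E < +oo)%E -> mu.-integrable [set: T] (EFin \o h).
Proof.
move=> mh h0 hoo; apply/integrableP; split; first exact/measurable_EFinP.
by under eq_integral do rewrite /= ger0_norm//.
Qed.

(** The dominating function is [1 + expR (nu * y)]: the first term serves where [y < 0], the second
    where [y >= 0]. *)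
Lemma integrable_expR_between d (T : measurableType d) (R : realType)
    (mu : probability T R) (b nu s : R) (y : T -> R) :
  measurable_fun [set: T] y -> (forall x, b <= y x) -> 0 <= s <= nu ->
  mu.-integrable [set: T] (fun x => (expR (nu * y x))%:E) ->
  mu.-integrable [set: T] (fun x => (expR (s * y x))%:E).
Proof.
move=> my yb /andP[s0 snu] iy.
have i1 : mu.-integrable [set: T] (EFin \o cst (1 : R)).
  exact: finite_measure_integrable_cst.
apply: (le_integrable _ _ _ (integrableD _ i1 iy)) => //.
  apply/measurable_EFinP; apply: measurableT_comp => //.
  exact: measurable_funM.
move=> x _ /=; rewrite lee_fin !ger0_norm ?addr_ge0 ?expR_ge0//.
have [y0|/ltW y0] := leP 0 (y x).
  by apply: ler_wpDl => //; rewrite ler_expR ler_wpM2r.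
by apply: ler_wpDr; rewrite ?expR_ge0// expR_le1 mulr_ge0_le0.
Qed.

(** Since [nu * y <= expR (nu * y)], the function []|b| + nu^-1 * expR (nu * y) [dominates]
    [|y|]. *)
Lemma integrable_of_expR d (T : measurableType d) (R : realType)
    (mu : probability T R) (b nu : R) (y : T -> R) :
  measurable_fun [set: T] y -> (forall x, b <= y x) -> 0 < nu ->
  mu.-integrable [set: T] (fun x => (expR (nu * y x))%:E) ->
  mu.-integrable [set: T] (EFin \o y).
Proof.
move=> my yb nu0 iy.
have i1 : mu.-integrable [set: T] (EFin \o cst `|b|).
  exact: finite_measure_integrable_cst.
have i2 := integrableZl measurableT nu^-1 iy.
apply: (le_integrable _ _ _ (integrableD _ i1 i2)) => //.
  exact/measurable_EFinP.
move=> x _ /=; rewrite lee_fin [leRHS]ger0_norm; last first.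
  by rewrite addr_ge0// mulr_ge0 ?expR_ge0// invr_ge0 ltW.
have e0 : 0 <= nu^-1 * expR (nu * y x).
  by rewrite mulr_ge0 ?expR_ge0// invr_ge0 ltW.
have [y0|/ltW y0] := leP 0 (y x).
  rewrite ger0_norm//; apply: ler_wpDl => //.
  rewrite mulrC ler_pdivlMr// mulrC.
  by have := expR_ge1Dx (nu * y x); lra.
apply: ler_wpDr => //; rewrite !ler0_norm//; last exact: le_trans y0.
by rewrite lerN2.
Qed.

(** * Exponential means and the limit of power means *)

Lemma probability_Rintegral_cst d (T : measurableType d) (R : realType)
    (mu : probability T R) (r : R) : \int[mu]_x r = r.
Proof.
rewrite Rintegral_cst// -[RHS]mulr1; congr (_ * _).
exact: (congr1 fine (probability_setT mu)).
Qed.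

(* Jensen's inequality: integrate [exp (s (y - m)) >= 1 + s (y - m)], where [m]
   is the mean of [y]. *)
Lemma expR_mean_le d (T : measurableType d) (R : realType)
    (mu : probability T R) (s : R) (y : T -> R) :
  mu.-integrable [set: T] (EFin \o y) ->
  mu.-integrable [set: T] (fun x => (expR (s * y x))%:E) ->
  expR (s * \int[mu]_x y x) <= \int[mu]_x expR (s * y x).
Proof.
move=> iy ies; set m := \int[mu]_x y x.
have ic (r : R) : mu.-integrable [set: T] (EFin \o cst r).
  exact: finite_measure_integrable_cst.
have i1 : mu.-integrable [set: T] (fun x => (s * y x)%:E).
  exact: (integrableZl measurableT s iy).
have i2 : mu.-integrable [set: T] (fun x => (1 - s * m + s * y x)%:E).
  exact: (integrableD measurableT (ic (1 - s * m)) i1).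
have i3 : mu.-integrable [set: T]
    (fun x => (expR (- (s * m)) * expR (s * y x))%:E).
  exact: (integrableZl measurableT (expR (- (s * m))) ies).
have := @le_Rintegral _ _ _ mu setT (fun x => 1 - s * m + s * y x)
  (fun x => expR (- (s * m)) * expR (s * y x)) measurableT i2 i3.
rewrite (@RintegralD _ _ _ mu setT (cst (1 - s * m)) (fun x => s * y x)
  measurableT (ic _) i1).
rewrite !RintegralZl// probability_Rintegral_cst -/m subrK => /(_ _)/wrap[].
  move=> x _; rewrite -expRD; apply: le_trans (expR_ge1Dx _); lra.
by rewrite expRN mulrC ler_pdivlMr ?expR_gt0// mul1r.
Qed.

(** The quadratic bound is integrated, and [1 + x <= expR x] then gives a right-hand side whose
    powers are explicit. The constant [K] is the integral of the coefficient of [s ^+ 2], so it does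
    not depend on [s]. *)
Lemma mean_expR_bound d (T : measurableType d) (R : realType)
    (mu : probability T R) (b nu : R) (y : T -> R) :
  measurable_fun [set: T] y -> (forall x, b <= y x) -> 0 < nu ->
  mu.-integrable [set: T] (fun x => (expR (nu * y x))%:E) ->
  exists K : R, forall s, 0 <= s -> s <= nu / 2 ->
    \int[mu]_x expR (s * y x) <= expR (s * \int[mu]_x y x + s ^+ 2 * K).
Proof.
move=> my yb nu0 ienu.
pose c := 16 / nu ^+ 2.
exists (b ^+ 2 + c * \int[mu]_x expR (nu * y x)) => s s0 snu.
have iy := integrable_of_expR my yb nu0 ienu.
have ies : mu.-integrable [set: T] (fun x => (expR (s * y x))%:E).
  by apply: (integrable_expR_between my yb _ ienu); lra.
have ic (r : R) : mu.-integrable [set: T] (EFin \o cst r).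
  exact: finite_measure_integrable_cst.
have i1 : mu.-integrable [set: T] (fun x => (s * y x)%:E).
  exact: (integrableZl measurableT s iy).
have i2 : mu.-integrable [set: T] (fun x => (s ^+ 2 * c * expR (nu * y x))%:E).
  exact: (integrableZl measurableT (s ^+ 2 * c) ienu).
have i12 : mu.-integrable [set: T]
    (fun x => (s * y x + s ^+ 2 * c * expR (nu * y x))%:E).
  exact: (integrableD measurableT i1 i2).
have i3 : mu.-integrable [set: T] (fun x => ((1 + s ^+ 2 * b ^+ 2) +
    (s * y x + s ^+ 2 * c * expR (nu * y x)))%:E).
  exact: (integrableD measurableT (ic _) i12).
apply: (le_trans (le_Rintegral measurableT ies i3 _)).
- move=> x _; apply: le_trans (expR_quadratic_bound nu0 s0 snu (yb x)) _.
  by rewrite -/c; lra.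
- rewrite (@RintegralD _ _ _ mu setT (cst (1 + s ^+ 2 * b ^+ 2))
    (fun x => s * y x + s ^+ 2 * c * expR (nu * y x)) measurableT (ic _) i12).
  rewrite (@RintegralD _ _ _ mu setT (fun x => s * y x) _ measurableT i1 i2).
  rewrite !RintegralZl// probability_Rintegral_cst.
  by apply: le_trans (expR_ge1Dx _); lra.
Qed.

(** Jensen's inequality with [s = n%:R^-1], raised to the power [n]; the resulting lower bound is
    the same for all [n]. *)
Lemma power_mean_ge d (T : measurableType d) (R : realType)
    (mu : probability T R) (y : T -> R) (n : nat) : (0 < n)%N ->
  mu.-integrable [set: T] (EFin \o y) ->
  mu.-integrable [set: T] (fun x => (expR (n%:R^-1 * y x))%:E) ->
  expR (\int[mu]_x y x) <= (\int[mu]_x expR (n%:R^-1 * y x)) ^+ n.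
Proof.
move=> n0 iy ie; have := expR_mean_le iy ie.
have -> : expR (\int[mu]_x y x) = expR (n%:R^-1 * \int[mu]_x y x) ^+ n.
  by rewrite -expRM_natl mulrA mulfV ?mul1r// pnatr_eq0 -lt0n.
move=> h; rewrite lerXn2r// nnegrE ?expR_ge0//.
exact: le_trans (expR_ge0 _) h.
Qed.

Lemma power_mean_le d (T : measurableType d) (R : realType)
    (mu : probability T R) (b nu : R) (y : T -> R) :
  measurable_fun [set: T] y -> (forall x, b <= y x) -> 0 < nu ->
  mu.-integrable [set: T] (fun x => (expR (nu * y x))%:E) ->
  exists K : R, forall n : nat, (0 < n)%N -> n%:R^-1 <= nu / 2 ->
    (\int[mu]_x expR (n%:R^-1 * y x)) ^+ n <=
    expR (\int[mu]_x y x + n%:R^-1 * K).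
Proof.
move=> my yb nu0 iy; have [K hK] := mean_expR_bound my yb nu0 iy.
exists K => n n0 nnu.
have nV0 : 0 <= n%:R^-1 :> R by rewrite invr_ge0.
have := hK _ nV0 nnu.
set m := \int[mu]_x y x => h.
have nn : n%:R != 0 :> R by rewrite pnatr_eq0 -lt0n.
have -> : m + n%:R^-1 * K = n%:R * (n%:R^-1 * m + n%:R^-1 ^+ 2 * K).
  by field.
rewrite expRM_natl lerXn2r// nnegrE ?expR_ge0//.
by apply: Rintegral_ge0 => x _; exact: expR_ge0.
Qed.

(** The two preceding bounds differ by the factor [expR (n%:R^-1 * K)], which tends to 1; the limit
    is the geometric mean of [expR (y x)]. *)
Lemma power_mean_cvg d (T : measurableType d) (R : realType)
    (mu : probability T R) (b nu : R) (y : T -> R) :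
  measurable_fun [set: T] y -> (forall x, b <= y x) -> 0 < nu ->
  mu.-integrable [set: T] (fun x => (expR (nu * y x))%:E) ->
  (\int[mu]_x expR (n%:R^-1 * y x)) ^+ n @[n --> \oo] -->
    expR (\int[mu]_x y x).
Proof.
move=> my yb nu0 iy; have [K hK] := power_mean_le my yb nu0 iy.
have inv0 : (n%:R^-1 : R) @[n --> \oo] --> 0.
  apply/gtr0_cvgV0; last exact: cvgr_idn.
  by near=> n; rewrite ltr0n; near: n; exact: nbhs_infty_gt.
have small : \forall n \near \oo, n%:R^-1 <= nu / 2.
  by apply: (cvgr_le _ inv0); rewrite divr_gt0.
apply: (@squeeze_cvgr _ _ _ _ (cst (expR (\int[mu]_x y x)))
   (fun n : nat => expR (\int[mu]_x y x + n%:R^-1 * K))).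
- near=> n.
  have n0 : (0 < n)%N by near: n; exact: nbhs_infty_gt.
  have ns : n%:R^-1 <= nu / 2 :> R by near: n.
  rewrite hK// andbT power_mean_ge//.
    exact: integrable_of_expR nu0 iy.
  apply: (integrable_expR_between my yb _ iy).
  by rewrite invr_ge0 ler0n/=; lra.
- exact: cvg_cst.
- apply: continuous_cvg; first exact: continuous_expR.
  rewrite -[X in _ --> X]addr0 -[X in _ + X](mul0r K).
  by apply: cvgD; [exact: cvg_cst|apply: cvgMl].
Unshelve. all: by end_near. Qed.

(** * Finite partitions and the expectation of the growth rate *)

Lemma measure_bigsetU_fin d (T : measurableType d) (R : realType)
    (mu : probability T R) (K : finType) (A : K -> set T) :
  (forall k, measurable (A k)) -> trivIset [set: K] A ->
  mu (\big[setU/set0]_k A k) = (\sum_k mu (A k))%E.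
Proof.
move=> mA tA.
have mU : measurable (\big[setU/set0]_k A k) by exact: bigsetU_measurable.
(* Measures are rewritten as integrals of 1, so that additivity of the integral over a finite
   disjoint union applies. *)
have cstE (B : set T) : measurable B -> mu B = (\int[mu]_(x in B) cst 1 x)%E.
  by move=> mB; rewrite integral_cst// mul1e.
rewrite cstE// ge0_integral_bigsetU//.
- by apply: eq_bigr => k _; rewrite integral_cst// mul1e.
- exact: index_enum_uniq.
- exact: sub_trivIset tA.
Qed.

(** The masses [q k] add up to 1, so the complement of the union is null and [W] integrates like a
    simple function, although its values are known only on the sets [A k]. *)
Lemma integral_fin_partition d (T : measurableType d) (R : realType)
    (mu : probability T R) (K : finType) (A : K -> set T) (c q : K -> R)
    (W : T -> R) :
  (forall k, measurable (A k)) -> trivIset [set: K] A ->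
  (forall k, mu (A k) = (q k)%:E) -> \sum_k q k = 1 ->
  measurable_fun [set: T] W -> (forall x, 0 <= W x) ->
  (forall k x, A k x -> W x = c k) ->
  (\int[mu]_x (W x)%:E)%E = (\sum_k c k * q k)%:E.
Proof.
move=> mA tA Aq q1 mW W0 Wc; set U := \big[setU/set0]_k A k.
have mU : measurable U by exact: bigsetU_measurable.
have muU : mu U = 1%E.
  rewrite measure_bigsetU_fin//; under eq_bigr do rewrite Aq.
  by rewrite sumEFin q1.
have mWE : measurable_fun [set: T] (EFin \o W) by exact/measurable_EFinP.
rewrite -(setUv U) ge0_integral_setU//=.
- rewrite [X in (_ + X)%E]null_set_integral; first last.
  + by have := probability_setC mu mU; rewrite muU subee.
  + exact: measurable_funTS.
  + exact: measurableC.
  rewrite adde0 ge0_integral_bigsetU//.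
  + rewrite -sumEFin; apply: eq_bigr => k _.
    rewrite EFinM -Aq -integral_cst//.
    by apply: eq_integral => x /set_mem /Wc /= ->.
  + exact: index_enum_uniq.
  + exact: sub_trivIset tA.
  + exact: measurable_funTS.
  + by move=> x _; rewrite lee_fin.
- exact: measurableC.
- by rewrite setUv.
- by move=> x _; rewrite lee_fin.
- by rewrite disj_set2E setICr.
Qed.

Lemma powR_prod (R : realType) (n : nat) (v : 'I_n -> R) (s : R) :
  (forall i, 0 < v i) ->
  (\prod_i v i) `^ s = \prod_i expR (s * ln (v i)).
Proof.
move=> v0; rewrite -expR_sum -mulr_sumr /powR gt_eqF ?prodr_gt0//.
congr (expR (s * _)).
elim: n v v0 => [|n IHn] v v0; first by rewrite !big_ord0 ln1.
by rewrite !big_ord_recl lnM ?posrE ?prodr_gt0// IHn.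
Qed.

Lemma measurable_growth_rate d (T : measurableType d) (R : realType)
    (P : probability T R) (Y : nat -> {RV P >-> R}) (u t : R) n :
  measurable_fun [set: T] (growth_rate u t Y n).
Proof.
apply: (measurableT_comp (measurable_powR n%:R^-1)).
apply: measurable_prod => i _; apply: measurable_funD => //.
apply: measurable_funB => //; apply: measurable_funM => //.
exact: measurable_funM.
Qed.

(* The expectation is expanded over the vectors [s] of levels taken by the
   first [n] draws; no general product rule for expectations is used. *)
Lemma expectation_growth_rate d (T : measurableType d) (R : realType)
    (P : probability T R) (Y : nat -> {RV P >-> R}) (m : nat) (l : nat -> R)
    (p : nat -> \bar R) (q : 'I_m.+1 -> R) (u t : R) (n : nat) :
  (0 < n)%N -> iid_draws Y m l p ->
  (forall j k : 'I_m.+1, l j = l k -> j = k) ->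
  (forall j : 'I_m.+1, p j = (q j)%:E) -> \sum_j q j = 1 ->
  (forall j : 'I_m.+1, 0 < l j * t / u - t + 1) ->
  'E_P[growth_rate u t Y n]%E =
  ((\sum_(j < m.+1) expR (n%:R^-1 * ln (l j * t / u - t + 1)) * q j) ^+ n)%:E.
Proof.
(* With [n.+1] draws the index type ['I_n.+1] is inhabited, as [inord] requires. *)
case: n => // n _ [indY lawY] linj pq q1 l0.
pose K := {ffun 'I_n.+1 -> 'I_m.+1}.
pose B (s : K) i : set R := [set l (s (inord i))].
(* The event that the first [n.+1] draws take the levels prescribed by [s]. The draws are indexed by
   [nat] to match [mutually_independent]. *)
pose A (s : K) := \bigcap_(i in [set` iota 0 n.+1]) (Y i @^-1` B s i).
have AE s w : A s w -> forall i : 'I_n.+1, Y i w = l (s i).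
  move=> As i.
  have si : (i : nat) \in iota 0 n.+1 by rewrite mem_iota /= ltn_ord.
  by have := As i si; rewrite /B inord_val.
have mA s : measurable (A s).
  apply: bigcap_measurableType => i _.
  exact: (measurable_funPTI (Y i) (measurable_set1 _)).
rewrite expectation.unlock (@integral_fin_partition _ _ _ P K A
   (fun s => \prod_i expR (n.+1%:R^-1 * ln (l (s i) * t / u - t + 1)))
   (fun s => \prod_i q (s i))).
(* Distributivity read backwards: the sum over all vectors of a product over draws is the power of a
   single sum. *)
- congr EFin; under eq_bigr do rewrite -big_split/=.
  rewrite -(bigA_distr_bigA (fun (i : 'I_n.+1) (j : 'I_m.+1) =>
    expR (n.+1%:R^-1 * ln (l j * t / u - t + 1)) * q j)).
  by rewrite prodr_const card_ord.
- exact: mA.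
- move=> s s' _ _ [w [/AE Es /AE Es']]; apply/ffunP => i; apply: linj.
  by rewrite -Es -Es'.
- move=> s; rewrite /A indY ?iota_uniq//; last first.
    by move=> i; exact: measurable_set1.
  rewrite -[iota _ _]/(index_iota 0 n.+1) big_mkord -prodEFin.
  apply: eq_bigr => i _; rewrite -pq /B inord_val lawY//.
  by rewrite -ltnS.
- transitivity (\prod_(i < n.+1) \sum_j q j); first by rewrite bigA_distr_bigA.
  by rewrite q1 prodr_const expr1n.
- exact: measurable_growth_rate.
- by move=> w; exact: powR_ge0.
- move=> s w /AE Es; rewrite /growth_rate -powR_prod//.
  by congr (_ `^ _); apply: eq_bigr => i _; rewrite Es.
Qed.

(* The value [c] given outside [I] does not affect integrals when [I] has full
   measure; [c = xi] keeps the growth factor positive on the whole line. *)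
Definition extend_const (R : realType) (I : interval R) (c : R) (g : R -> R)
    (x : R) : R := if x \in I then g x else c.

(** * Level sets and integrals of the step functions *)

Section step_functions.
Context (R : realType) (mu : probability (measurableTypeR R) R).
Context (I : interval R) (a : R -> R) (xi : R) (m : nat) (l : nat -> R).
Context (f : R -> R).
Hypotheses (muI : mu [set` I] = 1%E) (ma : measurable_fun [set` I] a).
Hypotheses (xia : forall x, x \in I -> xi <= a x).
Hypothesis (fstep : step_approx I a xi m l f).
Local Notation ext := (extend_const I xi).

Lemma step_levels_lt (j k : nat) : (j < k)%N -> (k <= m)%N -> l j < l k.
Proof.
have [_ lS _] := fstep; elim: k => // k IHk; rewrite ltnS leq_eqVlt.
move=> /predU1P[->|jk] km; first exact: lS.
by apply: lt_trans (lS _ km); apply: IHk => //; exact: ltnW.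
Qed.

Lemma step_levels_inj (j k : 'I_m.+1) : l j = l k -> j = k.
Proof.
move=> ljk; apply: val_inj => /=.
have hj := ltn_ord j; have hk := ltn_ord k.
by case: (ltngtP j k) => // /step_levels_lt; rewrite -ltnS => /(_ _)/wrap[]//;
  rewrite ljk ltxx.
Qed.

Lemma step_levels_ge (j : 'I_m.+1) : xi <= l j.
Proof.
have [<- _ _] := fstep; have := ltn_ord j; rewrite ltnS.
by case: (posnP j) => [->//|j0 jm]; exact/ltW/step_levels_lt.
Qed.

Lemma measurable_level_set j : measurable (level_set I a m l j).
Proof.
have mI : measurable [set` I] by exact: measurable_itv.
(* The last level has no upper constraint, hence the factor [setT] for [j >= m]. *)
have -> : level_set I a m l j = ([set` I] `&` a @^-1` `[l j, +oo[) `&`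
    (if (j < m)%N then [set` I] `&` a @^-1` `]-oo, l j.+1[ else setT).
  apply/seteqP; split => [x [xI lx ux]|x [[xI]]] /=.
    split; first by split => //=; rewrite in_itv/= lx.
    by case: ifPn => // jm; split => //=; rewrite in_itv/= ux.
  rewrite /= in_itv/= andbT => lx ux; split => // jm; move: ux.
  by rewrite jm => -[_] /=; rewrite in_itv.
apply: measurableI; first exact: ma.
by case: ifP => // _; exact: ma.
Qed.

Lemma level_set_cover :
  \big[setU/set0]_(j < m.+1) level_set I a m l j = [set` I].
Proof.
have [l0 _ _] := fstep.
apply/seteqP; split=> [x|x xI].
  by rewrite -bigcup_seq => -[j _ []].
rewrite -bigcup_seq.
(* The level of [x] is the largest [j <= m] with [l j <= a x]; one exists because
   [l 0 = xi <= a x]. *)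
have h0 : exists j, (j <= m)%N && (l j <= a x) by exists 0%N; rewrite l0 xia.
have hb j : (j <= m)%N && (l j <= a x) -> (j <= m)%N by case/andP.
have [j /andP[jm ljx] jmax] := ex_maxnP h0 hb.
exists (Ordinal (jm : (j < m.+1)%N)); first by rewrite /= mem_index_enum.
split=> //= jm'; rewrite ltNge; apply/negP => lx.
by have := jmax j.+1; rewrite jm' lx ltnn => /(_ isT).
Qed.

(** At a common point [f] would equal both [l j] and [l k], and the levels are distinct. *)
Lemma level_set_trivIset :
  trivIset [set: 'I_m.+1] (fun j : 'I_m.+1 => level_set I a m l j).
Proof.
have [_ _ fl] := fstep.
move=> j k _ _ [x [jx kx]]; apply: step_levels_inj.
by rewrite -(fl j x)// ?(fl k x)// -ltnS.
Qed.

Lemma sum_level_set :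
  \sum_(j < m.+1) fine (mu (level_set I a m l j)) = 1.
Proof.
apply: EFin_inj; rewrite -sumEFin -muI -level_set_cover.
rewrite measure_bigsetU_fin//; last exact: level_set_trivIset.
  apply: eq_bigr => j _; rewrite fineK// fin_num_measure//.
  exact: measurable_level_set.
by move=> j; exact: measurable_level_set.
Qed.

Lemma measurable_extend_const (g : R -> R) : measurable_fun [set` I] g ->
  measurable_fun [set: R] (ext g).
Proof.
move=> mg; have mI : measurable [set` I] by exact: measurable_itv.
rewrite -(setUv [set` I]); apply/measurable_funU => //.
  exact: measurableC.
split.
  by apply: eq_measurable_fun mg => x /set_mem /= xI; rewrite /extend_const xI.
apply: (eq_measurable_fun (cst xi)) => // x /set_mem /= /negP xI.
by rewrite /extend_const (negbTE xI).
Qed.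

Lemma measurable_extend_step : measurable_fun [set: R] (ext f).
Proof.
have [_ _ fl] := fstep.
apply: measurable_extend_const.
(* On [I] the function [f] is this combination of indicators, which is where its measurability comes
   from. *)
pose g x := \sum_(j < m.+1) l j * \1_(level_set I a m l j) x.
apply: (eq_measurable_fun g) => [x /set_mem xI|].
  have [j _ jx] :
      (\bigcup_(j in [set` index_enum 'I_m.+1]) level_set I a m l j) x.
    by rewrite bigcup_seq level_set_cover.
  rewrite (fl j)//; last by rewrite -ltnS.
  rewrite /g (bigD1 j)//= big1 ?addr0 => [|k kj].
    by rewrite indicE mem_set// mulr1.
  rewrite indicE memNset ?mulr0// => kx; move/eqP: kj; apply.
  by apply: (@level_set_trivIset k j) => //; exists x.
apply: measurable_sum => j; apply: measurable_funM => //.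
by apply: measurable_indic; exact: measurable_level_set.
Qed.

(** The level sets have total mass 1 because [I] does. This links the integrals over the line to the
    finite sums in the expectation, and shows that they are finite. *)
Lemma integral_step (h : R -> R) : measurable_fun [set: R] h ->
  (forall v, 0 <= h v) ->
  (\int[mu]_x (h (ext f x))%:E)%E =
  (\sum_(j < m.+1) h (l j) * fine (mu (level_set I a m l j)))%:E.
Proof.
move=> mh h0; have [_ _ fl] := fstep.
apply: (@integral_fin_partition _ _ _ mu 'I_m.+1
  (fun j => level_set I a m l j) (fun j => h (l j)) _ (h \o ext f)).
- by move=> j; exact: measurable_level_set.
- exact: level_set_trivIset.
- move=> j; rewrite fineK// fin_num_measure//; exact: measurable_level_set.
- exact: sum_level_set.
- by apply: measurableT_comp => //; exact: measurable_extend_step.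
- by move=> x; exact: h0.
- move=> j x jx; have [xI _ _] := jx.
  by rewrite /= /extend_const xI (fl j)// -ltnS.
Qed.

End step_functions.

(** * Power means along an increasing sequence of functions *)

Section monotone_power_means.
Context d (T : measurableType d) (R : realType) (mu : probability T R).
Context (y_ : nat -> T -> R) (y : T -> R) (b : R).
Hypotheses (my_ : forall N, measurable_fun [set: T] (y_ N))
  (my : measurable_fun [set: T] y).
Hypotheses (by_ : forall N x, b <= y_ N x)
  (yS : forall N x, y_ N x <= y_ N.+1 x) (y_y : forall N x, y_ N x <= y x)
  (y_cvg : forall x, y_ N x @[N --> \oo] --> y x).

Let y_homo x : {homo (y_ ^~ x) : n m / (n <= m)%N >-> n <= m}.
Proof. by apply/nondecreasing_seqP => n; exact: yS. Qed.

Let b_y x : b <= y x.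
Proof. exact: le_trans (by_ 0%N x) (y_y _ _). Qed.

Let measurable_expRZ (s : R) (z : T -> R) : measurable_fun [set: T] z ->
  measurable_fun [set: T] (fun x => expR (s * z x)).
Proof. by move=> mz; apply: measurableT_comp => //; exact: measurable_funM. Qed.

Let integrable_approx N s : 0 <= s ->
  mu.-integrable [set: T] (fun x => (expR (s * y x))%:E) ->
  mu.-integrable [set: T] (fun x => (expR (s * y_ N x))%:E).
Proof.
move=> s0; apply: le_integrable => //.
  by apply/measurable_EFinP; exact: measurable_expRZ.
by move=> x _; rewrite lee_fin !ger0_norm ?expR_ge0// ler_expR ler_wpM2l.
Qed.

Lemma mean_log_cvg (nu : R) : 0 < nu ->
  mu.-integrable [set: T] (fun x => (expR (nu * y x))%:E) ->
  expR (\int[mu]_x y_ N x) @[N --> \oo] --> expR (\int[mu]_x y x).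
Proof.
move=> nu0 ienu; apply: continuous_cvg; first exact: continuous_expR.
have iy := integrable_of_expR my b_y nu0 ienu.
have ib : mu.-integrable [set: T] (EFin \o cst `|b|).
  exact: finite_measure_integrable_cst.
(* From [b <= y_ N x <= y x], this function dominates all the approximations. *)
have idom : mu.-integrable [set: T] (fun x => (`|b| + `|y x|)%:E).
  exact: (integrableD measurableT ib (integrable_abse iy)).
have cvgE : {ae mu, forall x, [set: T] x ->
    (y_ N x)%:E @[N --> \oo] --> (y x)%:E}.
  by apply: aeW => x _; apply: cvg_EFin; [exact: nearW|exact: y_cvg].
have dom : {ae mu, forall x N, [set: T] x ->
    (`|(y_ N x)%:E| <= (`|b| + `|y x|)%:E)%E}.
  apply: aeW => x N _; rewrite lee_fin ler_norml.
  have h1 := by_ N x; have h2 := y_y N x; have h3 := ler_norm (y x).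
  have h4 := ler_norm (- b); rewrite normrN in h4.
  have h5 := normr_ge0 b; have h6 := normr_ge0 (y x).
  by apply/andP; split; lra.
have [_ _ h] := dominated_convergence measurableT
  (fun N => (measurable_EFinP _ _).2 (my_ N)) ((measurable_EFinP _ _).2 my)
  cvgE idom dom.
apply: fine_cvg; rewrite /Rintegral fineK; first exact: h.
exact: integrable_fin_num.
Qed.

(** The lower bound [G N] depends on [N] only, the upper bound [H n] on [n] only, and both tend to
    [L]; this gives the double limit. For fixed [N] the limit in [n] is that of power means; for
    fixed [n] the limit in [N] exists by monotonicity. *)
Lemma monotone_power_means_cvg (nu : R) (E : nat -> nat -> \bar R) : 0 < nu ->
  mu.-integrable [set: T] (fun x => (expR (nu * y x))%:E) ->
  (forall N n, (0 < n)%N ->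
    mu.-integrable [set: T] (fun x => (expR (n%:R^-1 * y_ N x))%:E)) ->
  (forall N n, (0 < n)%N ->
    E N n = ((\int[mu]_x expR (n%:R^-1 * y_ N x)) ^+ n)%:E) ->
  exists (lim_n : nat -> \bar R) (lim_N : nat -> \bar R) (L : R),
    [/\ forall N, E N n @[n --> \oo] --> lim_n N,
        forall n, (0 < n)%N -> E N n @[N --> \oo] --> lim_N n,
        lim_n N @[N --> \oo] --> L%:E,
        lim_N n @[n --> \oo] --> L%:E &
        E q.1 q.2 @[q --> (\oo, \oo)] --> L%:E].
Proof.
move=> nu0 ienu i_ EE.
pose G N := expR (\int[mu]_x y_ N x).
pose H n := (\int[mu]_x expR (n%:R^-1 * y x)) ^+ n.
pose L := expR (\int[mu]_x y x).
have ie_ N : mu.-integrable [set: T] (fun x => (expR (nu * y_ N x))%:E).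
  exact/integrable_approx/ienu/ltW.
have small : \forall n \near \oo, (0 < n)%N && (n%:R^-1 <= nu :> R).
  have inv0 : (n%:R^-1 : R) @[n --> \oo] --> 0.
    apply/gtr0_cvgV0; last exact: cvgr_idn.
    by near=> n; rewrite ltr0n; near: n; exact: nbhs_infty_gt.
  near=> n; apply/andP; split; near: n; first exact: nbhs_infty_gt.
  exact: (cvgr_le _ inv0).
have ies n : (n%:R^-1 <= nu :> R) ->
    mu.-integrable [set: T] (fun x => (expR (n%:R^-1 * y x))%:E).
  move=> nnu; apply: (integrable_expR_between my b_y _ ienu).
  by rewrite invr_ge0 ler0n.
have cvgE U (F : set_system U) (FF : Filter F) (h : U -> R) (c : R) :
    h x @[x --> F] --> c -> (h x)%:E @[x --> F] --> c%:E.
  by move=> hc; apply: cvg_EFin; [exact: nearW|exact: hc].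
have GL : (G N)%:E @[N --> \oo] --> L%:E.
  by apply: cvgE; exact: mean_log_cvg ienu.
have HL : (H n)%:E @[n --> \oo] --> L%:E.
  by apply: cvgE; exact: power_mean_cvg my b_y nu0 ienu.
have le_power n (z z' : T -> R) :
    mu.-integrable [set: T] (fun x => (expR (n%:R^-1 * z x))%:E) ->
    mu.-integrable [set: T] (fun x => (expR (n%:R^-1 * z' x))%:E) ->
    (forall x, z x <= z' x) ->
    (\int[mu]_x expR (n%:R^-1 * z x)) ^+ n <=
    (\int[mu]_x expR (n%:R^-1 * z' x)) ^+ n.
  move=> iz iz' zz'; apply: lerXn2r; rewrite ?nnegrE.
  - by apply: Rintegral_ge0 => x _; exact: expR_ge0.
  - by apply: Rintegral_ge0 => x _; exact: expR_ge0.
  - apply: le_Rintegral => // x _.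
    by rewrite ler_expR ler_wpM2l// invr_ge0.
have GEH N n : (0 < n)%N -> n%:R^-1 <= nu :> R ->
    ((G N)%:E <= E N n <= (H n)%:E)%E.
  move=> n0 nnu; rewrite EE// !lee_fin.
  apply/andP; split.
    apply: power_mean_ge => //; last exact: i_.
    exact: (integrable_of_expR (my_ N) (by_ N) nu0 (ie_ N)).
  apply: le_power => //; [exact: i_|exact: ies].
(* The limit in [N] is taken in the extended reals: it may be [+oo] for the small [n] with
   [n%:R^-1 > nu]. *)
exists (fun N => (G N)%:E), (fun n => limn (E ^~ n)), L.
have EN_cvg n : (0 < n)%N -> cvgn (E ^~ n).
  move=> n0; apply: ereal_nondecreasing_is_cvgn => N N' NN'.
  rewrite (EE N) ?(EE N') ?lee_fin; [|exact: n0|exact: n0].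
  apply: le_power => //; [exact: i_|exact: i_|].
  by move=> x; exact: y_homo.
split.
- move=> N.
  have h : ((\int[mu]_x expR (n%:R^-1 * y_ N x)) ^+ n)%:E @[n --> \oo] -->
      (G N)%:E.
    by apply: cvgE; exact: power_mean_cvg (my_ N) (by_ N) nu0 (ie_ N).
  (* The formula for [E N n] is available for [n > 0] only, so the two sequences agree
     eventually. *)
  have e : {near \oo,
      (fun n => ((\int[mu]_x expR (n%:R^-1 * y_ N x)) ^+ n)%:E) =1 E N}.
    by near=> n; rewrite EE//; near: n; exact: nbhs_infty_gt.
  exact: (cvg_trans (near_eq_cvg e) h).
- exact: EN_cvg.
- exact: GL.
(* Letting [N] tend to infinity in [GEH] puts the inner limit between [L] and [H n]. *)
- apply: (@squeeze_cvge _ _ _ _ (cst L%:E) _ (fun n => (H n)%:E)) => //;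
    last first.
    exact: cvg_cst.
  near=> n.
  have /andP[n0 nnu] : (0 < n)%N && (n%:R^-1 <= nu :> R) by near: n.
  apply/andP; split.
    rewrite -(cvg_lim _ GL)//; apply: lee_lim => //.
    - by apply/cvg_ex; exists L%:E.
    - exact: EN_cvg.
    - by apply: nearW => N; have /andP[] := GEH N n n0 nnu.
  apply: lime_le; first exact: EN_cvg.
  by apply: nearW => N; have /andP[] := GEH N n n0 nnu.
- apply: (@squeeze_cvge _ _ _ _ (fun q => (G q.1)%:E) _ (fun q => (H q.2)%:E)).
  + have : \forall q \near (\oo, \oo), (0 < q.2)%N && (q.2%:R^-1 <= nu :> R).
      exact: (cvg_snd small).
    by apply: filterS => q /andP[q0 qnu]; exact: GEH.
  + by apply: cvg_comp GL; exact: cvg_fst.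
  + by apply: cvg_comp HL; exact: cvg_snd.
Unshelve. all: by end_near. Qed.

(** Monotone convergence sends the integrals to [+oo], and their powers follow. *)
Lemma monotone_power_means_infinite (n : nat) (E : nat -> \bar R) : (0 < n)%N ->
  (\int[mu]_x (expR (n%:R^-1 * y x))%:E = +oo)%E ->
  (forall N, (\int[mu]_x (expR (n%:R^-1 * y_ N x))%:E < +oo)%E) ->
  (forall N, E N = ((\int[mu]_x expR (n%:R^-1 * y_ N x)) ^+ n)%:E) ->
  E N @[N --> \oo] --> +oo%E.
Proof.
move=> n0 yoo fin EE.
have n0' : 0 <= n%:R^-1 :> R by rewrite invr_ge0.
have : (\int[mu]_x (expR (n%:R^-1 * y_ N x))%:E)%E @[N --> \oo] --> +oo%E.
  rewrite -yoo.
  have -> : (\int[mu]_x (expR (n%:R^-1 * y x))%:E =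
      \int[mu]_x limn (fun N => (expR (n%:R^-1 * y_ N x))%:E))%E.
    apply: eq_integral => x _; apply/esym/cvg_lim => //.
    apply: cvg_EFin; first exact: nearW.
    apply: continuous_cvg; first exact: continuous_expR.
    by apply: cvgMr; exact: y_cvg.
  apply: cvg_monotone_convergence => //.
  - by move=> N; apply/measurable_EFinP; exact: measurable_expRZ.
  - by move=> x _ N N' NN'; rewrite lee_fin ler_expR ler_wpM2l// y_homo.
move=> /cvgeyPge h; apply/cvgeyPge => A.
(* The threshold 1 ensures that the [n]-th power of the integral is at least the integral itself. *)
apply: filterS (h (Num.max A 1)) => N.
have fN : (\int[mu]_x (expR (n%:R^-1 * y_ N x))%:E)%E \is a fin_num.
  by rewrite ge0_fin_numE// integral_ge0// => x _; rewrite lee_fin expR_ge0.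
rewrite EE -(fineK fN) !lee_fin ge_max => /andP[AE E1]; apply: (le_trans AE).
by rewrite /Rintegral -[leLHS]expr1; apply: ler_weXn2l.
Qed.

End monotone_power_means.

(** * Logarithm of the growth factor *)

Definition log_growth (R : realType) (u t v : R) : R := ln (v * t / u - t + 1).

Section log_growth.
Context (R : realType) (u t xi : R).
Hypotheses (u0 : 0 < u) (t0 : 0 <= t) (xi_gt0 : 0 < xi * t / u - t + 1).

Lemma le_growth (v w : R) : v <= w -> v * t / u - t + 1 <= w * t / u - t + 1.
Proof. by move=> vw; rewrite !lerD2r -!mulrA ler_wpM2r// divr_ge0// ltW. Qed.

Lemma growth_gt0 (v : R) : xi <= v -> 0 < v * t / u - t + 1.
Proof. by move=> /le_growth; exact: lt_le_trans. Qed.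

Lemma le_log_growth (v w : R) : xi <= v -> v <= w ->
  log_growth u t v <= log_growth u t w.
Proof.
move=> xiv vw; rewrite /log_growth ler_ln ?posrE ?growth_gt0 ?le_growth//.
exact: le_trans vw.
Qed.

Lemma measurable_log_growth : measurable_fun [set: R] (log_growth u t).
Proof.
apply: measurableT_comp => //; apply: measurable_funD => //.
apply: measurable_funB => //; apply: measurable_funM => //.
exact: measurable_funM.
Qed.

Lemma log_growth_cvg (g : nat -> R) (v : R) : xi <= v ->
  g N @[N --> \oo] --> v ->
  log_growth u t (g N) @[N --> \oo] --> log_growth u t v.
Proof.
move=> xiv gv; rewrite /log_growth.
apply: (cvg_comp (fun N => g N * t / u - t + 1) (@ln R)); last first.
  by apply: continuous_ln; exact: growth_gt0.
apply: cvgD; last exact: cvg_cst.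
apply: cvgB; last exact: cvg_cst.
by apply: cvgMl; apply: cvgMl.
Qed.

End log_growth.

(** * Effectiveness as an exponential moment of the log growth *)

Section effective_games.
Context (R : realType) (mu : probability (measurableTypeR R) R).
Context (I : interval R) (a : R -> R) (xi u t : R).
Hypotheses (ma : measurable_fun [set` I] a)
  (xia : forall x, x \in I -> xi <= a x).
Hypotheses (u0 : 0 < u) (t0 : 0 <= t) (xi_gt0 : 0 < xi * t / u - t + 1).
Local Notation y x := (log_growth u t (extend_const I xi a x)).
Let Da := [set` I] `&` [set x | 1 < a x].

Let mDa : measurable Da.
Proof.
have -> : Da = [set` I] `&` a @^-1` `]1, +oo[.
  by apply/seteqP; split=> x [xI ax]; split=> //=; move: ax;
    rewrite /= in_itv/= andbT.
by apply: ma => //; exact: measurable_itv.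
Qed.

Let mpow (nu : R) : measurable_fun Da (fun x => a x `^ nu).
Proof.
apply: (measurableT_comp (measurable_powR nu)).
apply: measurable_funS ma; [exact: measurable_itv|exact: subIsetl].
Qed.

Let my : measurable_fun [set: R] (fun x => y x).
Proof.
apply: (measurableT_comp (measurable_log_growth u t)).
exact: measurable_extend_const.
Qed.

(** With [C = t / u + 1], the growth factor is at most [C] where [a <= 1] and at most [C * a] where
    [a > 1], so the exponent [nu] of the definition works. *)
Lemma effective_integrable : effective mu I a ->
  exists2 nu : R, 0 < nu &
    mu.-integrable [set: R] (fun x => (expR (nu * y x))%:E).
Proof.
move=> [nu [nu0 anu]]; exists nu => //.
pose C := t / u + 1; pose h := (fun x => a x `^ nu) \_ Da.
have tu0 : 0 <= t / u by rewrite divr_ge0// ltW.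
have C0 : 0 < C by rewrite /C; lra.
have mh : measurable_fun [set: R] h by apply/(measurable_restrictT _ mDa).
have h0 x : 0 <= h x.
  by rewrite /h /patch; case: ifP => // _; exact: powR_ge0.
have ih : mu.-integrable [set: R] (EFin \o h).
  apply: integrable_ge0 => //.
  rewrite (_ : (\int[mu]_x (h x)%:E = \int[mu]_(x in Da) (a x `^ nu)%:E)%E)//.
  rewrite [RHS]integral_mkcond; apply: eq_integral => x _.
  by rewrite /h /patch; case: ifP.
(* [e0] is the value outside [I], and [e1] is [C] to the power [nu]; [e0 + e1 + e1 * h] covers all
   the cases at once. *)
pose e0 := expR (nu * log_growth u t xi); pose e1 := expR (nu * ln C).
have i0 : mu.-integrable [set: R] (EFin \o cst (e0 + e1)).
  exact: finite_measure_integrable_cst.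
have i1 : mu.-integrable [set: R] (fun x => (e0 + e1 + e1 * h x)%:E).
  exact: (integrableD measurableT i0 (integrableZl measurableT e1 ih)).
apply: le_integrable i1 => //.
  apply/measurable_EFinP; apply: measurableT_comp => //; exact: measurable_funM.
move=> x _; rewrite lee_fin ger0_norm ?expR_ge0//.
have e00 : 0 <= e0 by exact: expR_ge0.
have e10 : 0 <= e1 by exact: expR_ge0.
have e1h : 0 <= e1 * h x by rewrite mulr_ge0.
rewrite [leRHS]ger0_norm ?addr_ge0// /extend_const; case: ifPn => xI; last first.
  by rewrite -/e0; lra.
have g0 := growth_gt0 u0 t0 xi_gt0 (xia xI).
have [a1|a1] := leP (a x) 1.
  suff : expR (nu * log_growth u t (a x)) <= e1 by lra.
  rewrite ler_expR ler_wpM2l ?(ltW nu0)// /log_growth ler_ln ?posrE//.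
  have := le_growth u0 t0 a1; rewrite /C mul1r => gle.
  by apply: (le_trans gle); rewrite lerD2r gerBl.
suff le1 : expR (nu * log_growth u t (a x)) <= e1 * h x.
  by apply: (le_trans le1); rewrite ler_wpDl ?addr_ge0.
have a0 : 0 < a x by lra.
rewrite /h /patch mem_set// /powR gt_eqF// /e1 -expRD ler_expR -mulrDr.
rewrite ler_wpM2l ?(ltW nu0)// -lnM ?posrE// /log_growth.
rewrite ler_ln ?posrE ?mulr_gt0//.
have -> : C * a x = a x * t / u + a x by rewrite /C; field; rewrite gt_eqF.
by have := t0; lra.
Qed.

(** For [t > 0] the growth factor [g] in turn controls [a]: [a <= K * g] where [a > 1]. A finite
    integral would thus make the game effective with exponent [s]. *)
Lemma ineffective_integral (s : R) : 0 < t -> 0 < s -> ~ effective mu I a ->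
  (\int[mu]_x (expR (s * y x))%:E = +oo)%E.
Proof.
move=> t_gt0 s0 ineff; apply/eqP; rewrite -leye_eq leNgt; apply/negP => fin.
apply: ineff; exists s; split => //.
pose c := xi * t / u - t + 1; pose K := u / t + `|xi| / c.
have K0 : 0 < K by rewrite ltr_wpDr ?divr_gt0// divr_ge0// ltW.
have mE : measurable_fun [set: R]
    (fun x => (expR (s * ln K) * expR (s * y x))%:E).
  apply/measurable_EFinP; apply: measurable_funM => //.
  by apply: measurableT_comp => //; exact: measurable_funM.
have E0 x : (0 <= (expR (s * ln K) * expR (s * y x))%:E)%E.
  by rewrite lee_fin mulr_ge0 ?expR_ge0.
apply: (@le_lt_trans _ _
  (\int[mu]_(x in Da) (expR (s * ln K) * expR (s * y x))%:E)%E).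
  apply: ge0_le_integral => //.
  - by move=> x _; rewrite lee_fin powR_ge0.
  - by apply/measurable_EFinP; exact: mpow.
  - exact: measurable_funTS.
  - move=> x [xI /= a1]; rewrite lee_fin /extend_const xI.
    have a0 : 0 < a x by lra.
    have := xia xI => ax; have g0 := growth_gt0 u0 t0 xi_gt0 ax.
    rewrite /powR gt_eqF// -expRD ler_expR -mulrDr ler_wpM2l ?(ltW s0)//.
    rewrite -lnM ?posrE// ler_ln ?posrE ?mulr_gt0//.
    have cg : c <= a x * t / u - t + 1 by exact: le_growth.
    set g := a x * t / u - t + 1 in g0 cg *.
    have -> : a x = u / t * (g - c) + xi.
      by rewrite /g /c; field; rewrite !gt_eqF.
    have : xi <= `|xi| / c * g.
      apply: (le_trans (ler_norm xi)); rewrite mulrAC ler_pdivlMr//.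
      by rewrite ler_wpM2l.
    have : 0 <= u / t * c by rewrite mulr_ge0 ?divr_ge0// ltW.
    by rewrite /K mulrDl; nra.
apply: (@le_lt_trans _ _ (\int[mu]_x (expR (s * ln K) * expR (s * y x))%:E)%E).
  by apply: ge0_subset_integral.
under eq_integral do rewrite EFinM.
rewrite (@ge0_integralZl_EFin _ _ _ mu setT measurableT
  (fun x => (expR (s * y x))%:E))//.
- by rewrite lte_mul_pinfty// lee_fin expR_ge0.
- apply/measurable_EFinP; apply: measurableT_comp => //; exact: measurable_funM.
Qed.

End effective_games.

(** * Limits of the expected growth rate *)

Theorem lemma5p4 (R : realType)
    (* the game (a, F) on the interval I *)
    (I : interval R) (F : cumulativeBounded (0 : R) (1 : R))
    (hF : dF F [set` I] = 1%E)
    (a : R -> R) (ma : measurable_fun [set` I] a)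
    (xi : R) (hxi : ereal_inf [set (a x)%:E | x in [set` I]] = xi%:E)
    (hess : forall e : R, 0 < e ->
      (0 < dF F ([set` I] `&` [set x | (a x < xi + e)%R]))%E)
    (hconst : ~ exists c : R, {ae dF F, forall x, x \in I -> a x = c})
    (hint : (0 < \int[dF F]_(x in [set` I]) (a x)%:E)%E)
    (* the approximating step functions; f N has the M N + 1 levels l N j *)
    (f : nat -> R -> R) (M : nat -> nat) (l : nat -> nat -> R)
    (hstep : forall N, step_approx I a xi (M N) (l N) (f N))
    (hf_ge : forall N x, x \in I -> xi <= f N x)
    (hf_mono : forall N x, x \in I -> f N x <= f N.+1 x)
    (hf_le : forall N x, x \in I -> f N x <= a x)
    (hf_cvg : forall x, x \in I -> f N x @[N --> \oo] --> a x)
    (u t : R) (hu : 0 < u) (ht : 0 <= t) (hut : 0 < xi * t / u - t + 1)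
    (* for each N, i.i.d. draws of the game {(l N j, p_j)} *)
    (d : nat -> measure_display) (T : forall N, measurableType (d N))
    (P : forall N, probability (T N) R) (Y : forall N, nat -> {RV P N >-> R})
    (hY : forall N, iid_draws (Y N) (M N) (l N)
      (fun j => dF F (level_set I a (M N) (l N) j))) :
  let EX N n := 'E_(P N)[growth_rate u t (Y N) n]%E in
  (effective (dF F) I a ->
    exists (lim_n : nat -> \bar R) (lim_N : nat -> \bar R) (L : R),
      [/\ forall N, EX N n @[n --> \oo] --> lim_n N,
          forall n, (0 < n)%N -> EX N n @[N --> \oo] --> lim_N n,
          lim_n N @[N --> \oo] --> L%:E,
          lim_N n @[n --> \oo] --> L%:E &
          EX q.1 q.2 @[q --> (\oo, \oo)] --> L%:E]) /\
  (~ effective (dF F) I a -> 0 < t ->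
    forall n, (0 < n)%N -> EX N n @[N --> \oo] --> +oo%E).
Proof.
move=> EX.
have xia x : x \in I -> xi <= a x.
  by move=> xI; rewrite -lee_fin -hxi; apply: ereal_inf_lbound; exists x.
pose ext := extend_const I xi.
(* The logarithms of the growth factors, with [xi] substituted outside [I], so that bounds,
   monotonicity and convergence hold at every real point. *)
pose y N (x : measurableTypeR R) := log_growth u t (ext (f N) x).
pose yoo (x : measurableTypeR R) := log_growth u t (ext a x).
have ext_ge g x : (forall x, x \in I -> xi <= g x) -> xi <= ext g x.
  by move=> h; rewrite /ext /extend_const; case: ifPn => // /h.
have ext_le g g' x : (forall x, x \in I -> g x <= g' x) -> ext g x <= ext g' x.
  by move=> h; rewrite /ext /extend_const; case: ifPn => // /h.
have my N : measurable_fun [set: measurableTypeR R] (y N).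
  apply: (measurableT_comp (measurable_log_growth u t)).
  exact: measurable_extend_step ma xia (hstep N).
have myoo : measurable_fun [set: measurableTypeR R] yoo.
  apply: (measurableT_comp (measurable_log_growth u t)).
  exact: measurable_extend_const.
have y_ge N x : log_growth u t xi <= y N x.
  by apply: (le_log_growth hu ht hut (lexx xi)); apply: ext_ge; exact: hf_ge.
have y_S N x : y N x <= y N.+1 x.
  apply: (le_log_growth hu ht hut); first by apply: ext_ge; exact: hf_ge.
  by apply: ext_le; exact: hf_mono.
have y_le N x : y N x <= yoo x.
  apply: (le_log_growth hu ht hut); first by apply: ext_ge; exact: hf_ge.
  by apply: ext_le; exact: hf_le.
have y_cvg x : y N x @[N --> \oo] --> yoo x.
  apply: (log_growth_cvg hu ht hut); first exact: ext_ge.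
  rewrite /ext /extend_const; case: ifPn => xI; last exact: cvg_cst.
  exact: hf_cvg.
(* A finite sum, hence finite whether or not the game is effective; both cases rely on this. *)
have int_y N s : (\int[dF F]_x (expR (s * y N x))%:E)%E =
    (\sum_(j < (M N).+1) expR (s * log_growth u t (l N j)) *
       fine (dF F (level_set I a (M N) (l N) j)))%:E.
  apply: (integral_step hF ma xia (hstep N)
    (h := fun v => expR (s * log_growth u t v))) => [|v]; last exact: expR_ge0.
  apply: measurableT_comp => //; apply: measurable_funM => //.
  exact: measurable_log_growth.
have EXE N n : (0 < n)%N ->
    EX N n = ((\int[dF F]_x expR (n%:R^-1 * y N x)) ^+ n)%:E.
  move=> n0; rewrite /EX.
  rewrite (expectation_growth_rate n0 (hY N)
    (q := fun j => fine (dF F (level_set I a (M N) (l N) j)))).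
  - by congr (_ ^+ n)%:E; rewrite /Rintegral int_y.
  - exact: step_levels_inj (hstep N).
  - move=> j; rewrite fineK// fin_num_measure//.
    exact: measurable_level_set.
  - exact: sum_level_set hF ma xia (hstep N).
  - move=> j; apply: (growth_gt0 hu ht hut).
    exact: step_levels_ge (hstep N) j.
split=> [/(effective_integrable ma xia hu ht hut)[nu nu0 inu]|ineff t0 n n0].
  apply: (monotone_power_means_cvg my myoo y_ge y_S y_le y_cvg nu0 inu) => //.
  move=> N n n0; apply: integrable_ge0 => [|x|]; last by rewrite int_y ltry.
    by apply: measurableT_comp => //; exact: measurable_funM.
  exact: expR_ge0.
apply: (monotone_power_means_infinite my y_S y_cvg n0).
- apply: (ineffective_integral ma xia hu ht hut t0 _ ineff).
  by rewrite invr_gt0 ltr0n.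
- by move=> N; rewrite int_y ltry.
- by move=> N; exact: EXE.
Qed.
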